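(* Let $\tau:[0,1]\to\mathbb{R}$ be the Takagi function, and let level sets $L(y)$ and local level sets $L_x^{loc}$ be defined as in the context. Then: (1) Each local level set $L_x^{loc}$ is a closed set contained in some level set $L(y)$. (2) Two local level sets $L_x^{loc}$ and $L_{x'}^{loc}$ either coincide or are disjoint. Thus each level set $L(y)$ partitions into a disjoint union of local level sets.
   Context: The Takagi function is $\tau(x)=\sum_{n=0}^\infty 2^{-n}\operatorname{dist}(2^n x,\mathbb{Z})$ for $x\in[0,1]$, where $\operatorname{dist}(t,\mathbb{Z})=\inf_{m\in\mathbb{Z}}|t-m|$; its values lie in $[0,\frac23]$. Convention: in level sets and local level sets, an element $x$ specifies a binary expansion $x=0.b_1b_2b_3\ldots=\sum_{j\ge1} b_j2^{-j}$ with $b_j\in\{0,1\}$; a dyadic rational in $(0,1)$ occurs twice, labelled by its two binary expansions (which are treated as distinct elements). Topological statements (closedness) refer to the set of real numbers represented. For $0\le y\le \frac23$, the level set is $L(y)=\{x\in[0,1]:\tau(x)=y\}$ (where each element $x$ specifies a binary expansion, so that a dyadic rational in $(0,1)$ with $\tau(x)=y$ occurs twice, as two distinct elements labelled by its two binary expansions). For a binary expansion $x=0.b_1b_2\ldots$ put $D_0(x)=0$ and $D_j(x)=j-2(b_1+\cdots+b_j)$ for $j\ge1$. The balance-set is $Z(x)=\{j\ge 0: D_j(x)=0\}=\{c_0<c_1<c_2<\cdots\}$ with $c_0=0$; if $Z(x)$ is finite with last element $c_n$, set $c_{n+1}=+\infty$. The $k$-th block $B_k(x)$ is the indexed string of digits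 $(b_j)_{c_k<j\le c_{k+1}}$ (all $j>c_k$ if $c_{k+1}=+\infty$). Two expansions are equivalent, $x\sim x'$, if $Z(x)=Z(x')$ and for each $k$ the block $B_k(x')$ either equals $B_k(x)$ or is obtained from it by flipping every digit ($b_j\mapsto 1-b_j$ for all $j$ in the block). The local level set of $x$ is $L_x^{loc}=\{x': x'\sim x\}$. *)

(* Defs.v *)
From mathcomp Require Import all_boot all_order all_algebra.
From mathcomp Require Import all_classical all_reals all_analysis.
Import Order.TTheory GRing.Theory Num.Theory.
Import numFieldNormedType.Exports.

Set Implicit Arguments.
Unset Strict Implicit.
Unset Printing Implicit Defensive.

Local Open Scope classical_set_scope.
Local Open Scope ring_scope.

Definition dist_int (R : realType) (t : R) : R :=
  inf (range (fun m : int => `|t - m%:~R|)).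

(* The series converges for every real [x]; only its values on [0, 1] are used,
   since that is where [exp_value] takes its values. *)
Definition takagi (R : realType) (x : R) : R :=
  limn (series (fun n : nat => 2 ^- n * dist_int (2 ^+ n * x))).

(* An element of a (local) level set is a binary expansion 0.b_1 b_2 b_3 ...,
   so a dyadic rational in (0, 1) gives two elements. Digits are numbered from
   1, while [x : expansion] is indexed from 0, hence the shift in [digit]. *)
Definition expansion : Type := nat -> bool.

Definition digit (x : expansion) (j : nat) : bool := x j.-1.

Definition exp_value (R : realType) (x : expansion) : R :=
  limn ((fun n => \sum_(1 <= j < n.+1) (digit x j)%:R * 2 ^- j) : R^nat).

Definition level_set (R : realType) (y : R) : set expansion :=
  [set x | takagi (exp_value R x) = y].

Definition deficient_digit (x : expansion) (j : nat) : int :=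
  j%:Z - 2 * (\sum_(1 <= i < j.+1) digit x i)%N%:Z.

Definition balance_set (x : expansion) : set nat :=
  [set j | deficient_digit x j = 0].

(* The least element of [balance_set x] above [m], or [None] for +oo. *)
Definition next_balance (x : expansion) (m : nat) : option nat :=
  match pselect (exists j, (m < j)%N && (deficient_digit x j == 0)) with
  | left ex_j => Some (ex_minn ex_j)
  | right _ => None
  end.

(* c_0 < c_1 < ...; once +oo is reached the value stays [None]. *)
Fixpoint balance_point (x : expansion) (k : nat) : option nat :=
  if k is k'.+1 then obind (next_balance x) (balance_point x k') else Some 0%N.

(* c_k < j <= c_{k+1}; no index qualifies when c_k is not a finite point. *)
Definition in_block (x : expansion) (k j : nat) : bool :=
  if balance_point x k is Some c then
    (c < j)%N && (if balance_point x k.+1 is Some c' then (j <= c')%N else true)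
  else false.

(* A string of digits indexed by a set of positions is a partial function. *)
Definition block (x : expansion) (k : nat) : nat -> option bool :=
  fun j => if in_block x k j then Some (digit x j) else None.

Definition flip (B : nat -> option bool) : nat -> option bool :=
  fun j => omap negb (B j).

Definition exp_equiv (x x' : expansion) : Prop :=
  balance_set x = balance_set x' /\
  forall k, block x' k = block x k \/ block x' k = flip (block x k).

Definition local_level_set (x : expansion) : set expansion :=
  [set x' | exp_equiv x x'].

(* Main.v *)
Require Import Defs.
From mathcomp Require Import all_boot all_order all_algebra.
From mathcomp Require Import all_classical all_reals all_analysis.
From mathcomp Require Import zify ring lra.
Import Order.TTheory GRing.Theory Num.Theory.
Import numFieldNormedType.Exports.
Local Open Scope classical_set_scope.
Local Open Scope ring_scope.

(** Everything rests on one observation: two expansions are equivalent exactly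
    when |D_j| agrees for every j (lemma [exp_equivP]). Flipping a block
    negates the walk D between two consecutive zeros; conversely D cannot
    change sign inside a block, so knowing |D| there leaves only one global
    sign to choose. Hence equivalence is an equivalence relation, local level
    sets are its classes, and any two of them coincide or are disjoint.

    The Takagi function sees an expansion only through the squares of the walk:
<<
      tau(x) = 3/4 - (1/8) * sum_(n >= 0) D_n(x)^2 / 2^n
>>
    (lemma [takagi_exp_value]), so it is constant on a local level set. To find
    this formula let t_n = 0.b_(n+1) b_(n+2)... be the fractional tail,
    s = 1 - 2 b_(n+1) the next step of the walk and u_n = 1 - 2 t_n. Then
    dist(2^n x, Z) = (1 - s u_n) / 2, while u_(n+1) = 2 u_n - s and
    D_(n+1) = D_n + s, so that
<<
      s u_n / 2^n = D_(n+1) u_(n+1) / 2^(n+1) - D_n u_n / 2^n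
                    + (s D_n + 1) / 2^(n+1),
>>
    and s D_n = (D_(n+1)^2 - D_n^2 - 1) / 2. Summing gives an exact expression
    for the partial sums ([takagi_partial_sum]) whose remainder is nonnegative
    and tends to 0. Its sign bounds the series of D_n^2 / 2^n, which therefore
    converges; this in turn forces the remainder to vanish in the limit. The
    bound tau <= 2/3 is also read off the formula: D_n is odd for odd n, so
    D_n^2 >= 1 there and the series is at least 1/2 + 1/8 + ... = 2/3.

    Closedness is a compactness argument. In the Cantor space of expansions the
    conditions on |D_j| involve finitely many digits each, so a local level set
    is closed, hence compact, and its image under the continuous map
    [exp_value] is compact. *)

(** * The walk D and its blocks *)

Lemma deficient_digit0 (x : expansion) : deficient_digit x 0 = 0.
Proof. by rewrite /deficient_digit big_geq. Qed.

Lemma deficient_digitS (x : expansion) (j : nat) :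
  deficient_digit x j.+1 = deficient_digit x j + (if x j then -1 else 1).
Proof.
rewrite /deficient_digit big_nat_recr //= [digit x j.+1]/digit /=.
by case: (x j) => /=; lia.
Qed.

Lemma odd_deficient_digit (x : expansion) (j : nat) :
  odd `|deficient_digit x j| = odd j.
Proof.
elim: j => [|j IH]; first by rewrite deficient_digit0.
by rewrite deficient_digitS /=; case: (x j); lia.
Qed.

Lemma next_balance_gt (x : expansion) (m c : nat) :
  next_balance x m = Some c -> (m < c)%N.
Proof.
rewrite /next_balance; case: pselect => // ex_j [<-].
by case: ex_minnP => j /andP[].
Qed.

Lemma next_balance_deficient (x : expansion) (m c : nat) :
  next_balance x m = Some c -> deficient_digit x c = 0.
Proof.
rewrite /next_balance; case: pselect => // ex_j [<-].
by case: ex_minnP => j /andP[_ /eqP].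
Qed.

Lemma next_balance_None (x : expansion) (m j : nat) :
  next_balance x m = None -> (m < j)%N -> deficient_digit x j != 0.
Proof.
rewrite /next_balance; case: pselect => // nex_j _ ltmj.
by apply/eqP => Dj; apply: nex_j; exists j; rewrite ltmj Dj eqxx.
Qed.

Lemma next_balance_min (x : expansion) (m c j : nat) :
  next_balance x m = Some c -> (m < j < c)%N -> deficient_digit x j != 0.
Proof.
rewrite /next_balance; case: pselect => // ex_j [<-].
case: ex_minnP => i _ minP /andP[ltmj ltji].
by apply/eqP => Dj; have := minP j; rewrite ltmj Dj eqxx => /(_ isT); lia.
Qed.

Lemma eq_next_balance (x x' : expansion) (m : nat) :
  balance_set x = balance_set x' -> next_balance x m = next_balance x' m.
Proof.
move=> eqZ.
have E j : (deficient_digit x j == 0) = (deficient_digit x' j == 0).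
  have := congr1 (@^~ j) eqZ; rewrite /balance_set /= => eqP_.
  by apply/eqP/eqP; rewrite eqP_.
rewrite /next_balance; case: pselect => exj; case: pselect => exj' //.
- congr Some; case: ex_minnP => i Pi mini; case: ex_minnP => i' Pi' mini'.
  by apply/eqP; rewrite eqn_leq mini ?E // mini' -?E.
- by case: exj' ; case: exj => j; rewrite E => ?; exists j.
- by case: exj ; case: exj' => j; rewrite -E => ?; exists j.
Qed.

Lemma eq_balance_point (x x' : expansion) :
  balance_set x = balance_set x' -> balance_point x =1 balance_point x'.
Proof.
move=> eqZ; elim=> //= k ->.
by case: (balance_point x' k) => //= c; exact: eq_next_balance.
Qed.

Lemma eq_in_block (x x' : expansion) (k j : nat) :
  balance_set x = balance_set x' -> in_block x k j = in_block x' k j.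
Proof. by move=> eqZ; rewrite /in_block !(eq_balance_point _ _ eqZ). Qed.

Lemma in_blockP (x : expansion) (k j : nat) :
  in_block x k j -> exists2 c, balance_point x k = Some c & (c < j)%N.
Proof. by rewrite /in_block; case: balance_point => // c /andP[]; exists c. Qed.

Lemma in_block_pred (x : expansion) (k c j : nat) :
  balance_point x k = Some c -> (c < j)%N -> in_block x k j.+1 -> in_block x k j.
Proof.
rewrite /in_block /= => -> -> /=; case: next_balance => //= c'.
by move=> /andP[_]; lia.
Qed.

(** Inside a block the walk stays away from 0. The last position of a block is
    excluded, which is why the successor of [j] has to be in the block too. *)
Lemma in_block_deficient (x : expansion) (k c j : nat) :
  balance_point x k = Some c -> (c < j)%N -> in_block x k j.+1 ->
  deficient_digit x j != 0.
Proof.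
rewrite /in_block /= => -> ltcj /=; case E: next_balance => [c'|] /andP[_ lej].
  by apply: (next_balance_min _ _ _ _ E); rewrite ltcj.
exact: (next_balance_None _ _ _ E).
Qed.

Lemma balance_point_deficient (x : expansion) (k c : nat) :
  balance_point x k = Some c -> deficient_digit x c = 0.
Proof.
case: k => [[<-]|k /=]; first exact: deficient_digit0.
by case: balance_point => //= m; exact: next_balance_deficient.
Qed.

Lemma in_block_cover (x : expansion) (j : nat) : exists k, in_block x k j.+1.
Proof.
elim: j => [|j [k]].
  exists 0%N; rewrite /in_block /=; case E: next_balance => [c|] //.
  exact: (next_balance_gt _ _ _ E).
rewrite /in_block; case Ek: balance_point => [c|] // /andP[ltcj].
case Ek1: balance_point => [c'|] lej; last first.
  by exists k; rewrite Ek Ek1; lia.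
have [ec'|ltjc'] := eqVneq c' j.+1; last first.
  by exists k; rewrite Ek Ek1; lia.
subst c'; exists k.+1; rewrite Ek1 [balance_point _ _.+2]/= -/(balance_point x k.+1) Ek1 /=.
case E: next_balance => [c2|]; last by lia.
by have := next_balance_gt _ _ _ E; lia.
Qed.

(** Both alternatives at once: a block is kept or flipped according to a single
    bit added modulo 2 to all its digits. *)
Lemma block_flipP (x x' : expansion) (k : nat) :
    balance_set x = balance_set x' ->
  (block x' k = block x k \/ block x' k = flip (block x k)) <->
  exists e : bool, forall j, in_block x k j -> digit x' j = e (+) digit x j.
Proof.
move=> eqZ; split=> [[eqB|eqB]|[e He]].
- exists false => j kj; have := congr1 (@^~ j) eqB.
  by rewrite /block -(eq_in_block _ _ k j eqZ) kj => -[].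
- exists true => j kj; have := congr1 (@^~ j) eqB.
  by rewrite /flip /block -(eq_in_block _ _ k j eqZ) kj => -[].
- case: e He => He; [right|left]; apply/funext => j;
  by rewrite /flip /block -(eq_in_block _ _ k j eqZ); case: ifP => // /He ->.
Qed.

(** On a block, x' arises from x by adding a bit e to all digits iff the walk of
    x' is (-1)^e times that of x. Backwards, e is read off the first step after
    the balance point; while D_j is nonzero, |D_(j+1)| tells whether the next
    step goes away from 0 or towards it, which fixes the next digit. *)
Lemma exp_equivP (x x' : expansion) :
  exp_equiv x x' <->
  forall j, `|deficient_digit x' j| = `|deficient_digit x j|.
Proof.
split=> [[eqZ eqB] [|j]|eqD].
- by rewrite !deficient_digit0.
- have [k kj] := in_block_cover x j.
  have [e He] := (block_flipP _ _ k eqZ).1 (eqB k).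
  have [c ck ltcj] := in_blockP _ _ _ kj.
  have Dc := balance_point_deficient _ _ _ ck.
  have Dc' : deficient_digit x' c = 0.
    by move: Dc; have := congr1 (@^~ c) eqZ; rewrite /balance_set /= => ->.
  suff -> : deficient_digit x' j.+1 = (-1) ^+ e * deficient_digit x j.+1.
    by case: (e); rewrite ?expr1 ?expr0; lia.
  (* Induction along the block; its first step starts from D_c = 0. *)
  elim: j kj ltcj => [|j IH] kj ltcj.
  + have c0 : c = 0%N by lia.
    subst c; rewrite !deficient_digitS Dc Dc'.
    have := He _ kj; rewrite /digit /= => ->.
    by case: (e); case: (x 0%N) => /=; rewrite ?expr1 ?expr0.
  + have := He _ kj; rewrite !(deficient_digitS _ j.+1) /digit /= => ->.
    have [ejc|nejc] := eqVneq c j.+1.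
      rewrite -ejc Dc Dc'.
      by case: (e); case: (x c) => /=; rewrite ?expr1 ?expr0.
    have ltcj1 : (c < j.+1)%N by lia.
    rewrite IH //; last exact: (in_block_pred _ _ _ _ ck).
    by case: (e); case: (x j.+1) => /=; rewrite ?expr1 ?expr0; lia.
- have eqZ : balance_set x = balance_set x'.
    by apply/funext => j; apply/propext; rewrite /balance_set /=;
       have := eqD j; split; lia.
  split=> // k; apply/(block_flipP _ _ k eqZ).
  case ck: (balance_point x k) => [c|]; last first.
    by exists false => j /in_blockP[c]; rewrite ck.
  have Dc := balance_point_deficient _ _ _ ck.
  have Dc' : deficient_digit x' c = 0 by have := eqD c; lia.
  exists (x c (+) x' c).
  suff H j : in_block x k j.+1 ->
      digit x' j.+1 = x c (+) x' c (+) digit x j.+1 /\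
      deficient_digit x' j.+1 = (-1) ^+ (x c (+) x' c) * deficient_digit x j.+1.
    by case=> [/in_blockP[]//|j kj]; case: (H _ kj).
  elim: j => [|j IH] kj.
    have [c' + ltc'] := in_blockP _ _ _ kj; rewrite ck => -[?]; subst c'.
    have c0 : c = 0%N by lia.
    subst c; rewrite !deficient_digitS Dc Dc' /digit /=.
    by case: (x 0%N); case: (x' 0%N).
  have [c' + ltc'] := in_blockP _ _ _ kj; rewrite ck => -[?]; subst c'.
  have [ejc|nejc] := eqVneq c j.+1.
    rewrite !(deficient_digitS _ j.+1) -ejc Dc Dc' /digit /=.
    by case: (x c); case: (x' c).
  have ltcj1 : (c < j.+1)%N by lia.
  have [_ ED] := IH (in_block_pred _ _ _ _ ck ltcj1 kj).
  have := in_block_deficient _ _ _ _ ck ltcj1 kj.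
  have := eqD j.+2; rewrite !(deficient_digitS _ j.+1) ED /digit /=.
  by case: (_ (+) _); case: (x j.+1); case: (x' j.+1);
     rewrite ?expr0 ?expr1 /=; lia.
Qed.

(** * Values of expansions *)

Definition tail (x : expansion) (n : nat) : expansion := fun k => x (n + k)%N.

Definition exp_partial (R : realType) (x : expansion) : R^nat :=
  fun n => \sum_(1 <= j < n.+1) (digit x j)%:R * 2 ^- j.

Lemma exp_partialS (R : realType) (x : expansion) (n : nat) :
  exp_partial R x n.+1 = ((x 0%N)%:R + exp_partial R (tail x 1) n) / 2.
Proof.
rewrite /exp_partial big_nat_recl // mulrDl expr1; congr (_ + _).
rewrite big_distrl /=; apply: eq_big_nat => i /andP[i_gt0 _].
by rewrite /digit /tail /= add1n prednK // exprS invfM mulrA mulrAC.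
Qed.

Lemma exp_partial_ge0 (R : realType) (x : expansion) (n : nat) :
  0 <= exp_partial R x n.
Proof. by apply: sumr_ge0 => i _; rewrite mulr_ge0 ?invr_ge0 ?exprn_ge0. Qed.

Lemma exp_partial_le1 (R : realType) (x : expansion) (n : nat) :
  exp_partial R x n <= 1.
Proof.
elim: n x => [|n IH] x; first by rewrite /exp_partial big_geq.
rewrite exp_partialS; have := IH (tail x 1).
by case: (x 0%N) => /=; lra.
Qed.

Lemma exp_partial_cvg (R : realType) (x : expansion) :
  exp_partial R x @ \oo --> exp_value R x.
Proof.
apply: nondecreasing_is_cvgn.
  apply/nondecreasing_seqP => n; rewrite /exp_partial [leRHS]big_nat_recr //= lerDl.
  by rewrite mulr_ge0 ?invr_ge0 ?exprn_ge0.
by exists 1 => _ [n _ <-]; exact: exp_partial_le1.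
Qed.

Lemma exp_value_ge0 (R : realType) (x : expansion) : 0 <= exp_value R x.
Proof.
apply: limr_ge; first exact: exp_partial_cvg.
by near=> n; exact: exp_partial_ge0.
Unshelve. all: by end_near. Qed.

Lemma exp_value_le1 (R : realType) (x : expansion) : exp_value R x <= 1.
Proof.
apply: limr_le; first exact: exp_partial_cvg.
by near=> n; exact: exp_partial_le1.
Unshelve. all: by end_near. Qed.

(** The shift on digits is the doubling map; all later inductions go through
    this recursion. *)
Lemma exp_value_head (R : realType) (x : expansion) :
  exp_value R x = ((x 0%N)%:R + exp_value R (tail x 1)) / 2.
Proof.
have cvS : exp_partial R x n.+1 @[n --> \oo] --> exp_value R x.
  by rewrite (cvg_shiftS (exp_partial R x)); exact: exp_partial_cvg.
rewrite -(cvg_lim _ cvS) //; apply: cvg_lim => //.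
rewrite (_ : (fun n => _) = fun n => ((x 0%N)%:R + exp_partial R (tail x 1) n) / 2);
  last by apply/funext => n /=; rewrite exp_partialS.
by apply: cvgM; first apply: cvgD; first [exact: cvg_cst|exact: exp_partial_cvg].
Qed.

Lemma exp_value_tail (R : realType) (x : expansion) (n : nat) :
  exp_value R (tail x n) = ((x n)%:R + exp_value R (tail x n.+1)) / 2.
Proof.
rewrite exp_value_head {1}/tail addn0; congr ((_ + exp_value R _) / _).
by apply/funext => k; rewrite /tail addnA addn1.
Qed.

Lemma exp_value_prefix (R : realType) (x x' : expansion) (n : nat) :
  (forall i, (i < n)%N -> x i = x' i) ->
  `|exp_value R x - exp_value R x'| <= 2 ^- n.
Proof.
elim: n x x' => [|n IH] x x' eqx.
  rewrite expr0 invr1 ler_norml.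
  have := exp_value_ge0 R x; have := exp_value_ge0 R x'.
  by have := exp_value_le1 R x; have := exp_value_le1 R x'; lra.
rewrite (exp_value_head R x) (exp_value_head R x') eqx //.
have -> (a b c : R) : (a + b) / 2 - (a + c) / 2 = (b - c) / 2 by field.
rewrite normrM (@gtr0_norm _ 2^-1) ?invr_gt0 // exprS invfM mulrC.
rewrite ler_pM2l ?invr_gt0 //.
by apply: IH => i lti; rewrite /tail eqx.
Qed.

(** * The distance to the nearest integer, read off the digits *)

Lemma dist_int_near (R : realType) (k : int) (t : R) :
  `|t| <= 1 / 2 -> dist_int (k%:~R + t) = `|t|.
Proof.
move=> t_small; apply/eqP; rewrite eq_le; apply/andP; split.
  apply: ge_inf; first by exists 0 => _ [m _ <-].
  by exists k => //; rewrite addrC addKr.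
apply: lb_le_inf; first by exists `|k%:~R + t - 0%:~R|, 0.
move=> _ [m _ <-]; rewrite addrAC -intrB.
have [->|nek] := eqVneq (k - m) 0; first by rewrite add0r.
have : 1 <= `|(k - m)%:~R : R|.
  by rewrite -intr_norm ler1z -gtz0_ge1 normr_gt0.
have := ler_normB ((k - m)%:~R + t) t; rewrite addrK.
by move: t_small; lra.
Qed.

(** The value dist(2^n x, Z): the tail 0.b_(n+1) b_(n+2)... is congruent to
    2^n x, and its first digit tells on which side of 1/2 it lies. *)
Definition saw (R : realType) (x : expansion) (n : nat) : R :=
  if x n then 1 - exp_value R (tail x n) else exp_value R (tail x n).

Lemma dist_int_exp_value (R : realType) (x : expansion) (n : nat) :
  dist_int (2 ^+ n * exp_value R x) = saw R x n.
Proof.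
have [k ->] : exists k : int,
    2 ^+ n * exp_value R x = k%:~R + exp_value R (tail x n).
  elim: n => [|n [k IH]]; first by exists 0; rewrite mul1r add0r.
  exists (2 * k + (x n)%:Z).
  by rewrite exprS -mulrA IH exp_value_tail intrD intrM -pmulrn; field.
have := exp_value_ge0 R (tail x n.+1); have := exp_value_le1 R (tail x n.+1).
rewrite /saw (exp_value_tail R x n); set t := exp_value R _.
case: (x n) => /= t_le1 t_ge0; last first.
  by rewrite dist_int_near ger0_norm //; lra.
(* The tail is at least 1/2, so the nearest integer is k + 1. *)
rewrite (_ : _ + _ = (k + 1)%:~R + ((t - 1) / 2)); last by rewrite intrD; field.
by rewrite dist_int_near ler0_norm; lra.
Qed.

Lemma saw_ge0 (R : realType) (x : expansion) (n : nat) : 0 <= saw R x n.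
Proof.
rewrite /saw; have := exp_value_ge0 R (tail x n).
by have := exp_value_le1 R (tail x n); case: (x n); lra.
Qed.


(** * The Takagi function as a quadratic series in the walk *)

Lemma cvg_expr_half (R : realType) : 2^-1 ^+ n @[n --> \oo] --> (0 : R).
Proof. by apply: cvg_expr; rewrite ger0_norm ?invr_ge0 // invf_lt1 // ltr1n. Qed.

Definition deficient_term (R : realType) (x : expansion) : R^nat :=
  fun n => (deficient_digit x n)%:~R ^+ 2 / 2 ^+ n.

Lemma deficient_term_ge0 (R : realType) (x : expansion) (n : nat) :
  0 <= deficient_term R x n.
Proof. by rewrite /deficient_term divr_ge0 ?sqr_ge0 ?exprn_ge0. Qed.

(** The telescoping identity, with u = 1 - 2 t_N where t_N is the N-th tail. The
    remainder is nonnegative since D^2 + 2 D u + 3 = (D + u)^2 + (3 - u^2) and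
    u lies in [-1, 1]. *)
Lemma takagi_partial_sum (R : realType) (x : expansion) (N : nat) :
  let D : R := (deficient_digit x N)%:~R in
  let u : R := 1 - 2 * exp_value R (tail x N) in
  series (fun n => 2 ^- n * saw R x n) N =
  3 / 4 - series (deficient_term R x) N / 8 - (D ^+ 2 + 2 * D * u + 3) / 4 / 2 ^+ N.
Proof.
elim: N => [|N] /=.
  by rewrite /series /= !big_geq // deficient_digit0 expr0; field.
rewrite /series /= !big_nat_recr //= => ->.
rewrite deficient_digitS intrD (exprS _ N) /saw /deficient_term (exp_value_tail R x N).
set D : R := (deficient_digit x N)%:~R.
set t := exp_value R _; set q := 2 ^+ N.
have q0 : q != 0 by rewrite expf_neq0.
by case: (x N) => /=; field.
Qed.

(** Partial sums are at most 6: in [takagi_partial_sum] both the left-hand side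
    and the subtracted remainder are nonnegative. *)
Lemma deficient_series_cvg (R : realType) (x : expansion) :
  cvgn (series (deficient_term R x)).
Proof.
apply: nondecreasing_is_cvgn.
  apply/nondecreasing_seqP => n.
  by rewrite /series /= [leRHS]big_nat_recr //= lerDl deficient_term_ge0.
exists 6 => _ [N _ <-].
have saw_N : 0 <= series (fun n => 2 ^- n * saw R x n) N.
  by apply: sumr_ge0 => n _; rewrite mulr_ge0 ?saw_ge0 ?invr_ge0 ?exprn_ge0.
move: saw_N; rewrite takagi_partial_sum.
set D : R := (deficient_digit x N)%:~R; set t := exp_value R _.
have t0 : 0 <= t := exp_value_ge0 _ _; have t1 : t <= 1 := exp_value_le1 _ _.
suff : 0 <= (D ^+ 2 + 2 * D * (1 - 2 * t) + 3) / 4 / 2 ^+ N by lra.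
rewrite !divr_ge0 ?exprn_ge0 //.
have -> : D ^+ 2 + 2 * D * (1 - 2 * t) + 3 =
   (D + (1 - 2 * t)) ^+ 2 + (2 + 4 * (t * (1 - t))) by ring.
by rewrite addr_ge0 ?sqr_ge0 // addr_ge0 // !mulr_ge0 // subr_ge0.
Qed.

(** The remainder lies between 0 and D_N^2 / 2^N + 1 / 2^N, whose first summand
    is the general term of a convergent series. *)
Lemma takagi_cvg (R : realType) (x : expansion) :
  series (fun n => 2 ^- n * dist_int (2 ^+ n * exp_value R x)) @ \oo -->
  3 / 4 - limn (series (deficient_term R x)) / 8.
Proof.
under eq_fun do rewrite dist_int_exp_value.
pose e N : R := ((deficient_digit x N)%:~R ^+ 2 +
  2 * (deficient_digit x N)%:~R * (1 - 2 * exp_value R (tail x N)) + 3) / 4 / 2 ^+ N.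
have -> : series (fun n => 2 ^- n * saw R x n) =
    fun N => 3 / 4 - series (deficient_term R x) N / 8 - e N.
  by apply/funext => N; rewrite takagi_partial_sum.
have cvD := deficient_series_cvg R x.
rewrite -[3 / 4 - _]subr0; apply: cvgB.
  by apply: cvgB; [exact: cvg_cst|by apply: cvgM cvD _; exact: cvg_cst].
apply: (@squeeze_cvgr _ _ _ _ (fun=> 0) (fun N => deficient_term R x N + 2^-1 ^+ N)).
- near=> N.
  rewrite /e /deficient_term exprVn.
  set D : R := (deficient_digit x N)%:~R; set t := exp_value R _.
  have t0 : 0 <= t := exp_value_ge0 _ _; have t1 : t <= 1 := exp_value_le1 _ _.
  have q0 : 0 < (2 ^+ N)^-1 :> R by rewrite invr_gt0 exprn_gt0.
  rewrite (_ : D ^+ 2 / 2 ^+ N + _ = (D ^+ 2 + 1) / 2 ^+ N); last first.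
    by rewrite mulrDl mul1r.
  have u1 : (1 - 2 * t) ^+ 2 <= 1 by nra.
  apply/andP; split; first by rewrite mulr_ge0 ?(ltW q0) //; nra.
  by rewrite ler_pM2r //; nra.
- exact: cvg_cst.
- have := cvgD (cvg_series_cvg_0 cvD) (cvg_expr_half R).
  by rewrite addr0; apply.
Unshelve. all: by end_near. Qed.

Lemma takagi_exp_value (R : realType) (x : expansion) :
  takagi (exp_value R x) = 3 / 4 - limn (series (deficient_term R x)) / 8.
Proof. by apply: cvg_lim => //; exact: takagi_cvg. Qed.

Lemma takagi_ge0 (R : realType) (x : expansion) : 0 <= takagi (exp_value R x).
Proof.
apply: limr_ge; first by apply/cvg_ex; eexists; exact: takagi_cvg.
near=> N; apply: sumr_ge0 => n _.
by rewrite dist_int_exp_value mulr_ge0 ?saw_ge0 ?invr_ge0 ?exprn_ge0.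
Unshelve. all: by end_near. Qed.

(** Since D_n^2 >= 1 for odd n, the partial sum is at least the sum of 2^-n over
    odd n < N. This is 2/3 minus the sum over odd n >= N, which is 4/3 or 2/3
    times 2^-N according to the parity of N. *)
Lemma deficient_series_ge (R : realType) (x : expansion) (N : nat) :
  2 / 3 - (if odd N then 4 / 3 else 2 / 3) * 2^-1 ^+ N
    <= series (deficient_term R x) N.
Proof.
elim: N => [|N IH]; first by rewrite /series /= big_geq // expr0; lra.
rewrite /series /= big_nat_recr //=; move: IH; rewrite /series /= => IH.
have : (odd N)%:R * 2^-1 ^+ N <= deficient_term R x N.
  rewrite /deficient_term exprVn ler_pM2r ?invr_gt0 ?exprn_gt0 //.
  case: (boolP (odd N)) => oddN; last exact: sqr_ge0.
  rewrite mulr1n -rmorphXn ler1z; have := odd_deficient_digit x N.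
  by rewrite oddN; nia.
have : 0 <= 2^-1 ^+ N :> R by rewrite exprn_ge0 ?invr_ge0.
move: IH; rewrite exprS; case: (odd N) => /=; lra.
Qed.

Lemma takagi_le (R : realType) (x : expansion) : takagi (exp_value R x) <= 2 / 3.
Proof.
rewrite takagi_exp_value.
suff : 2 / 3 <= limn (series (deficient_term R x)) by lra.
have cvL : 2 / 3 - 4 / 3 * 2^-1 ^+ n @[n --> \oo] --> (2 / 3 : R).
  have cst (c : R) : c @[_ --> \oo] --> c by exact: cvg_cst.
  have := cvgB (cst (2 / 3)) (cvgM (cst (4 / 3)) (cvg_expr_half R)).
  by rewrite mulr0 subr0; apply.
apply: (ler_cvg_to cvL (deficient_series_cvg R x)).
near=> N; apply: le_trans (deficient_series_ge R x N).
rewrite lerD2l lerN2 ler_wpM2r ?exprn_ge0 ?invr_ge0 //.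
by case: odd; lra.
Unshelve. all: by end_near. Qed.

Lemma takagi_equiv (R : realType) (x x' : expansion) :
  exp_equiv x x' -> takagi (exp_value R x') = takagi (exp_value R x).
Proof.
move=> /exp_equivP eqD; rewrite !takagi_exp_value.
suff -> : deficient_term R x' = deficient_term R x by [].
apply/funext => n; rewrite /deficient_term; congr (_ / _).
by rewrite -2!rmorphXn /= -(real_normK (num_real (deficient_digit x' n))) eqD
           real_normK ?num_real.
Qed.

(** * Closedness through the Cantor space *)

Lemma near_prefix (x : cantor_space) (n : nat) :
  \forall z \near x, forall i, (i < n)%N -> z i = x i.
Proof.
elim: n => [|n IH]; first by near=> z.
near=> z => i; rewrite ltnS leq_eqVlt => /predU1P[->|]; last by move: i; near: z.
near: z; exists (proj n @^-1` [set x n]); split => //.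
suff : @open cantor_space (proj n @^-1` [set x n]) by [].
by apply: open_comp; [move=> + _; exact: proj_continuous|exact: discrete_open].
Unshelve. all: by end_near. Qed.

Lemma exp_value_continuous (R : realType) :
  continuous (exp_value R : cantor_space -> R).
Proof.
move=> x; apply/cvgrPdist_le => eps eps_gt0.
have [n _ /(_ n (leqnn n))] := (cvgrPdist_le _ _).1 (cvg_expr_half R) _ eps_gt0.
rewrite /= sub0r normrN ger0_norm ?exprn_ge0 ?invr_ge0 // exprVn => n_eps.
near=> z; apply: le_trans n_eps; apply: exp_value_prefix => i lti.
by apply/esym; move: i lti; near: z; exact: near_prefix.
Unshelve. all: by end_near. Qed.

Lemma eq_deficient_digit (x x' : expansion) (n : nat) :
  (forall i, (i < n)%N -> x' i = x i) ->
  deficient_digit x' n = deficient_digit x n.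
Proof.
move=> eqx; rewrite /deficient_digit; congr (_ - _ * _%:Z).
by apply: eq_big_nat => -[|i] //= lti; rewrite /digit /= eqx.
Qed.

Lemma local_level_set_closed (x : expansion) :
  closed (local_level_set x : set cantor_space).
Proof.
move=> x' clx'; apply/exp_equivP => j.
have [z [/exp_equivP <- eqz]] := clx' _ (near_prefix x' j).
by rewrite (eq_deficient_digit x').
Qed.

Lemma exp_value_local_level_set_closed (R : realType) (x : expansion) :
  closed (exp_value R @` local_level_set x).
Proof.
apply: compact_closed; first exact: Rhausdorff.
apply: (@continuous_compact cantor_space).
  exact/continuous_subspaceT/exp_value_continuous.
by apply: subclosed_compact cantor_space_compact _ => //;
   exact: local_level_set_closed.
Qed.

(** * Local level sets as equivalence classes *)

Lemma eq_local_level_set (x x' : expansion) :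
  exp_equiv x x' -> local_level_set x = local_level_set x'.
Proof.
move=> /exp_equivP eqD; apply/funext => z; apply/propext.
by split=> /exp_equivP E; apply/exp_equivP => j; rewrite E eqD.
Qed.

Lemma local_level_set_refl (x : expansion) : local_level_set x x.
Proof. exact/exp_equivP. Qed.

Lemma eq_local_level_set_mem (x x' z : expansion) :
  local_level_set x z -> local_level_set x' z ->
  local_level_set x = local_level_set x'.
Proof. by move=> /eq_local_level_set -> /eq_local_level_set ->. Qed.

Lemma local_level_set_sub (R : realType) (x : expansion) :
  local_level_set x `<=` level_set (takagi (exp_value R x)).
Proof. by move=> z /(takagi_equiv R). Qed.

Theorem theorem1p3 (R : realType) :
  (forall x : expansion,
     closed (exp_value R @` local_level_set x) /\
     exists y : R, 0 <= y <= 2 / 3 /\ local_level_set x `<=` level_set y) /\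
  (forall x x' : expansion,
     local_level_set x = local_level_set x' \/
     local_level_set x `&` local_level_set x' = set0) /\
  (forall y : R, 0 <= y <= 2 / 3 ->
     partition (local_level_set @` level_set y) id (level_set y)).
Proof.
split; [|split].
- move=> x; split; first exact: exp_value_local_level_set_closed.
  exists (takagi (exp_value R x)); split; last exact: local_level_set_sub.
  by rewrite takagi_ge0 takagi_le.
- move=> x x'; have [->|/set0P[z [xz x'z]]] :=
    eqVneq (local_level_set x `&` local_level_set x') set0; first by right.
  by left; exact: eq_local_level_set_mem xz x'z.
- move=> y _; split.
  + apply/seteqP; split=> [z [_ [x <- <-]]|z yz]; first exact: local_level_set_sub.
    by exists (local_level_set z); [exists z|exact: local_level_set_refl].
  + move=> _ _ [x _ <-] [x' _ <-] [z [xz x'z]].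
    exact: eq_local_level_set_mem xz x'z.
  + by move=> _ [x _ <-]; exists x; exact: local_level_set_refl.
Qed.
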